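(* Let $Q$ be a finite left automorphic Moufang loop, $S\le Q$, and $x,y\in Q$ such that $xS\cap yS\neq\emptyset$. Then $|xS\cap yS|=|T|$ for some subloop $T$ of $S$. In particular, $|xS\cap yS|$ divides $|S|$.
   Context: A Moufang loop is a loop satisfying $((xy)x)z=x(y(xz))$. A loop is left automorphic if every left inner mapping (element of the stabilizer of $1$ in the group generated by the left translations $L_x:y\mapsto xy$) is an automorphism. $xS=\{xs:s\in S\}$. *)

(* Defs.v *)
From HB Require Import structures.
From mathcomp Require Import all_boot all_fingroup.
Set Implicit Arguments. Unset Strict Implicit. Unset Printing Implicit Defensive.

Definition is_loop (T : finType) (mul : T -> T -> T) (e : T) : Prop :=
  [/\ forall x, mul e x = x, forall x, mul x e = x,
      forall a, bijective (mul a) & forall a, bijective (fun x => mul x a)].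

Definition moufang (T : finType) (mul : T -> T -> T) : Prop :=
  forall x y z, mul (mul (mul x y) x) z = mul x (mul y (mul x z)).

Definition left_translations (T : finType) (mul : T -> T -> T) : {set {perm T}} :=
  [set p : {perm T} | [exists x, [forall z, p z == mul x z]]].

Definition left_inner_maps (T : finType) (mul : T -> T -> T) (e : T) : {set {perm T}} :=
  [set p in <<left_translations mul>>%g | p e == e].

Definition loop_automorphism (T : finType) (mul : T -> T -> T) (p : {perm T}) : Prop :=
  forall a b, p (mul a b) = mul (p a) (p b).

Definition left_automorphic (T : finType) (mul : T -> T -> T) (e : T) : Prop :=
  forall p, p \in left_inner_maps mul e -> loop_automorphism mul p.

Definition subloop (T : finType) (mul : T -> T -> T) (e : T) (S : {set T}) : Prop :=
  [/\ e \in S,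
      forall a b, a \in S -> b \in S -> mul a b \in S,
      forall a b c, a \in S -> b \in S -> mul a c = b -> c \in S &
      forall a b c, a \in S -> b \in S -> mul c a = b -> c \in S].

Definition loop_lcoset (T : finType) (mul : T -> T -> T) (x : T) (S : {set T}) : {set T} :=
  [set mul x s | s in S].

(* Main.v *)
Require Import Defs.
From mathcomp Require Import all_boot all_fingroup all_solvable.

(** Let [L_x] be left translation by [x] and
    [theta_{x,y} = L_{xy}^-1 L_x L_y], an automorphism.  If [z = xs = yt] lies in
    both cosets, then [xS = z theta_{x,s}(S)] and [yS = z theta_{y,t}(S)], so
    [xS :&: yS] has the size of the subloop of [u] in [S] with
    [theta_{x,s}(u)] in [theta_{y,t}(S)].

    Divisibility is Lagrange's theorem for subloops [A] of [B].  The left nucleus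
    [N] is normal, and since every [theta_{x,y}] is an automorphism,
    [(yx)^-1 (xy)] lies in [N]: [Q/N] is a commutative Moufang loop.  As
    [|A| = |A/N| |A :&: N|] and [A :&: N] is a group, one may assume that [Q] is
    commutative.

    In a finite commutative Moufang loop the group [M] generated by the left
    translations is nilpotent.  Indeed [theta_{x,y}] has order 3, [L_x^3] is
    central, and the associator of [x, y, z] is central in the subloop generated by
    [x, y, z], which makes [<L_x, L_y, L_z>] nilpotent of class at most 4.  As
    [L_x^g = L_{g x} L_{g 1}^-1] up to the order of composition, the Baer-Suzuki
    theorem puts the 3-part of every [L_x] in [O_3(M)], whence [M = O_3(M) Z(M)].
    Lagrange's theorem follows because [A] is the orbit of 1 under
    [<L_a : a in A>] and, in a nilpotent group [K], [|H : H :&: C|] divides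
    [|K : C|] for all subgroups [H] and [C]. *)

Set Implicit Arguments. Unset Strict Implicit. Unset Printing Implicit Defensive.
Local Open Scope group_scope.

(** * Nilpotent groups: indices and nilpotency criteria *)

(** Normalizers grow: unless [C = K], induction on [#|K : C|] handles [N = 'N_K(C)], and normality
    of [C] in [N] handles the remaining factor. *)
Lemma index_capI_dvd_nilpotent (gT : finGroupType) (K H C : {group gT}) :
  nilpotent K -> H \subset K -> C \subset K -> #|H : H :&: C| %| #|K : C|.
Proof.
move=> nilK sHK; have [n] := ubnP #|K : C|.
elim: n => // n IHn in C * => /ltnSE leCn sCK.
have [->|neqCK] := eqVneq (C : {set gT}) K.
  by rewrite (setIidPl sHK) !indexgg.
have prCK: C \proper K by rewrite properEneq neqCK.
pose N := 'N_K(C)%G.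
have prCN : C \proper N := nilpotent_proper_norm nilK prCK.
have sCN := proper_sub prCN.
have sNK : N \subset K := subsetIl _ _.
have nCN : C <| N by rewrite /normal sCN subsetIr.
have lag := Lagrange_index sNK sCN.
have iN1 : 1 < #|N : C| by rewrite indexg_gt1 proper_subn.
have iN : #|H : H :&: N| %| #|K : N|.
  apply: IHn => //; apply: leq_trans leCn; rewrite -lag.
  by rewrite -[ltnLHS]muln1 ltn_pmul2l // indexg_gt0.
have sHCN : H :&: C \subset H :&: N by rewrite setIS.
have iHC : #|H :&: N : H :&: C| %| #|N : C|.
  have -> : H :&: C = H :&: N :&: C by rewrite -setIA (setIidPr sCN).
  have nC : H :&: N \subset 'N(C).
    exact: subset_trans (subsetIr _ _) (normal_norm nCN).
  rewrite indexgI -!card_quotient ?(normal_norm nCN) //.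
  by rewrite cardSg // quotientS // subsetIr.
by rewrite -(Lagrange_index (subsetIl H N) sHCN) -lag dvdn_mul.
Qed.

(** Centralizers modulo ['Z_n] are subgroups, so generators suffice. *)
Lemma mem_ucnS_gen (gT : finGroupType) (X : {set gT}) (n : nat) (y : gT) :
    y \in <<X>> -> (forall s, s \in X -> [~ y, s] \in 'Z_n(<<X>>)) ->
  y \in 'Z_n.+1(<<X>>).
Proof.
move=> yX yZ; rewrite (ucnSnR n <<X>>%G) inE yX /=.
have nZ : <<X>> \subset 'N('Z_n(<<X>>)) := normal_norm (ucn_normal n <<X>>%G).
rewrite -quotient_cents2 ?sub1set ?(subsetP nZ) //.
rewrite quotient_gen ?cent_gen; last exact: subset_trans (subset_gen X) nZ.
rewrite quotient_cents2 ?sub1set ?(subsetP nZ) //; last first.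
  exact: subset_trans (subset_gen X) nZ.
rewrite gen_subG; apply/subsetP => z /imset2P[y' s /set1P-> sX ->].
exact: yZ.
Qed.

Lemma nilpotent_gen_comm5 (gT : finGroupType) (X : {set gT}) :
    (forall a b c d f, a \in X -> b \in X -> c \in X -> d \in X -> f \in X ->
      [~ a, b, c, d, f] = 1) ->
  nilpotent <<X>>.
Proof.
move=> comm1; apply/(ucnP <<X>>%G); exists 4; apply/eqP.
rewrite eqEsubset ucn_sub gen_subG /=; apply/subsetP => a aX.
have Xg := @mem_gen gT _ X.
have cg u v : u \in <<X>> -> v \in <<X>> -> [~ u, v] \in <<X>>.
  by move=> uX vX; exact: (@groupR _ <<X>>%G).
apply: mem_ucnS_gen => [|b bX]; first exact: Xg.
apply: mem_ucnS_gen => [|c cX]; first by rewrite ?cg ?Xg.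
apply: mem_ucnS_gen => [|d dX]; first by rewrite ?cg ?Xg.
apply: mem_ucnS_gen => [|f fX]; first by rewrite ?cg ?Xg.
by rewrite comm1 // group1.
Qed.

Lemma nilpotent_gen_central_cubes (gT : finGroupType) (X : {set gT}) :
    (forall u v, u \in X -> v \in X -> commute (u ^+ 3) v) ->
    (forall u g, u \in X -> g \in <<X>> ->
       nilpotent <<[set u; u ^ g]>>) ->
  nilpotent <<X>>.
Proof.
move=> cubeZ nilX; set M := <<X>>%G.
have sM : M \subset 'O_3(M) <*> 'Z(M).
  rewrite /= gen_subG; apply/subsetP => u uX.
  have uM : u \in M by exact: mem_gen.
  rewrite -(consttC 3 u) groupM //.
    apply: (subsetP (joing_subl _ _)); apply: Baer_Suzuki => [|g gM]; first by rewrite groupX.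
    set H := <<[set u; u ^ g]>>%G.
    have nilH : nilpotent H by exact: nilX.
    have HO := nilpotent_pcore_Hall 3 nilH.
    apply: (pgroupS _ (pcore_pgroup 3 H)); rewrite gen_subG.
    apply/subsetP => z; rewrite !inE => /orP[] /eqP-> {z}.
      rewrite (mem_Hall_pcore HO) ?p_elt_constt // groupX //.
      by rewrite mem_gen // !inE eqxx.
    rewrite -consttJ (mem_Hall_pcore HO) ?p_elt_constt // groupX //.
    by rewrite mem_gen // !inE eqxx orbT.
  apply: (subsetP (joing_subr _ _)).
  have cub : u ^+ 3 \in 'Z(M).
    rewrite inE groupX //= cent_gen; apply/centP => v vX; exact: cubeZ.
  (* The 3'-part of [u] has order prime to 3, so it is a power of its own cube, hence of the central
     [u ^+ 3]. *)
  have cop : coprime #[u.`_3^'] 3.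
    by rewrite coprime_sym; apply: (pnat_coprime (pi := 3)); rewrite ?pnat_id //;
       apply: p_elt_constt.
  have /cycleP[k ek] : u.`_3^' \in <[u.`_3^' ^+ 3]>.
    have /eqP <- : generator <[u.`_3^']> (u.`_3^' ^+ 3) by rewrite generator_coprime.
    exact: cycle_id.
  rewrite ek groupX //.
  have /cycleP[j ->] := cycle_constt 3^' u.
  by rewrite -expgM mulnC expgM groupX.
rewrite -(quotient_center_nil M).
have -> : M / 'Z(M) = 'O_3(M) / 'Z(M).
  apply/eqP; rewrite eqEsubset [X in _ && X]quotientS ?pcore_sub // andbT.
  have := quotientS 'Z(M) sM.
  rewrite quotientYidr //.
  by apply: subset_trans (pcore_sub 3 M) _; apply/normal_norm/center_normal.
by rewrite quotient_nil // (pgroup_nil (pcore_pgroup 3 M)).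
Qed.

(** * Commutative Moufang loops: inner maps and their identities *)

Section CommutativeMoufangLoop.
Variables (T : finType) (mul : T -> T -> T) (e : T) (inv : T -> T).
Local Notation "x ** y" := (mul x y) (at level 40, left associativity).
Hypothesis mulC : forall x y, x ** y = y ** x.
Hypothesis mul1 : forall x, e ** x = x.
Hypothesis mulK : forall x y, inv x ** (x ** y) = y.
Hypothesis mulKV : forall x y, x ** (inv x ** y) = y.
Hypothesis mulM : moufang mul.

Let mulI x : injective (mul x).
Proof. exact: can_inj (mulK x). Qed.

Let mule x : x ** e = x. Proof. by rewrite mulC mul1. Qed.
Let mulVx x : inv x ** x = e. Proof. by rewrite -[RHS](mulK x e) mule. Qed.
Let mulxV x : x ** inv x = e. Proof. by rewrite mulC mulVx. Qed.

Let inv_uniq x y : x ** y = e -> y = inv x.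
Proof. by move=> xy; apply: (@mulI x); rewrite xy mulxV. Qed.

Let invK x : inv (inv x) = x. Proof. by apply/esym/inv_uniq; rewrite mulVx. Qed.

Let invM x y : inv (x ** y) = inv x ** inv y.
Proof.
have h : x = (x ** y) ** inv y by rewrite mulC (mulC x) mulK.
have h2 : inv y = inv (x ** y) ** x by rewrite {2}h mulK.
by rewrite h2 (mulC _ x) mulK.
Qed.

Let mulM2 x y z : (x ** (x ** y)) ** z = x ** (y ** (x ** z)).
Proof. by rewrite -mulM [_ ** x]mulC. Qed.

Let sqr_mul x z : (x ** x) ** z = x ** (x ** z).
Proof. by have := mulM2 x e z; rewrite mule mul1. Qed.

Lemma cml_mulMM x y z : (x ** y) ** (x ** z) = x ** (x ** (y ** z)).
Proof.
have h : (x ** (x ** (y ** z))) ** inv (x ** z) = x ** y.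
  by rewrite invM mulM2 mulKV (mulC _ (inv z)) (mulC y) mulK.
by rewrite -h (mulC _ (inv _)) mulC mulKV.
Qed.

(* [inner x y] is [theta_{x,y}]. *)
Definition inner x y z := inv (x ** y) ** (x ** (y ** z)).

Let innerE x y z : x ** (y ** z) = (x ** y) ** inner x y z.
Proof. by rewrite mulKV. Qed.

(** By [cml_mulMM], multiplying two images doubles each translation and leaves a function [f] of the
    product alone; taking one factor [e] identifies [f]. *)
Lemma inner_morph x y a b : inner x y (a ** b) = inner x y a ** inner x y b.
Proof.
pose f c := inv (x ** y) ** (inv (x ** y) ** (x ** (x ** (y ** (y ** c))))).
have fE c d : inner x y c ** inner x y d = f (c ** d).
  by rewrite /inner cml_mulMM cml_mulMM cml_mulMM.
have ie : inner x y e = e by rewrite /inner mule mulVx.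
by rewrite fE -(mule (a ** b)) -fE ie mule mule.
Qed.

Let innere x y : inner x y e = e.
Proof. by rewrite /inner mule mulVx. Qed.

Let inner_inv x y z : inner x y (inv z) = inv (inner x y z).
Proof. by apply: inv_uniq; rewrite -inner_morph mulxV innere. Qed.

Let innerx x y : inner x y x = x.
Proof. by rewrite /inner (mulC y) (mulC x (x ** y)) mulK. Qed.

Let innery x y : inner x y y = y.
Proof. by rewrite /inner (mulC x (y ** y)) sqr_mul (mulC y x) (mulC y (x ** y)) mulK. Qed.

Let inner_xy x y : inner x y (x ** y) = x ** y.
Proof. by rewrite inner_morph innerx innery. Qed.

Let innerV x y z : inner (inv x) (inv y) z = inner x y z.
Proof.
by rewrite -[in RHS](invK z) inner_inv /inner !invM !invK.
Qed.

(** By [innerV], [inner x y z] also equals [(y ** x) ** (inv x ** (inv y ** z))], and [inner y x] is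
    multiplicative and fixes [y ** x]. *)
Let innerK x y z : inner y x (inner x y z) = z.
Proof.
have -> : inner x y z = (y ** x) ** (inv x ** (inv y ** z)).
  by rewrite -innerV /inner invM !invK (mulC y).
by rewrite inner_morph inner_xy {1}/inner !mulKV.
Qed.

Let inner_inj x y : injective (inner x y).
Proof. exact: can_inj (innerK x y). Qed.

Let inner_xM x y z : inner x y (x ** z) = x ** inner x y z.
Proof. by rewrite inner_morph innerx. Qed.

Let inner_yM x y z : inner x y (y ** z) = y ** inner x y z.
Proof. by rewrite inner_morph innery. Qed.

Let inner_xxy x y z : inner x (x ** y) z = inner x y z.
Proof.
apply: (@mulI (x ** (x ** y))); rewrite -innerE mulM2; congr (_ ** _).
by rewrite -inner_xM -inner_yM -innerV /inner invM !invK !mulK.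
Qed.

Let innerVx x y z : inner (inv x) y z = inner y x z.
Proof.
rewrite -{1}(mulK x y) inner_xxy; apply: (@inner_inj x y).
by rewrite innerK /inner (mulK x y) !mulKV mulK.
Qed.

Let innerVy x y z : inner x (inv y) z = inner y x z.
Proof. by rewrite -{1}[x]invK innerV innerVx. Qed.

(* [theta_{x,y}] permutes [z(xy)], [x(yz)], [y(zx)] cyclically, hence has order 3. *)
Let cycle1 x y z : inner x y (z ** (x ** y)) = x ** (y ** z).
Proof. by rewrite inner_morph inner_xy mulC mulKV. Qed.

Let cycle2 x y z : inner y z (z ** (x ** y)) = x ** (y ** z).
Proof.
apply: (@inner_inj z y); rewrite innerK (mulC x (y ** z)) inner_morph (mulC y z) inner_xy.
by rewrite -innerE (mulC y).
Qed.

Let cycle3 x y z : inner x y (x ** (y ** z)) = y ** (z ** x).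
Proof.
have h : inner x y (inv x ** (y ** z)) = z ** (inv x ** y).
  by apply: (@inner_inj y x); rewrite innerK -innerVx cycle1.
have -> : x ** (y ** z) = x ** (x ** (inv x ** (y ** z))) by rewrite mulKV.
by rewrite !inner_xM h -cml_mulMM mulKV mulC (mulC x).
Qed.

Let inner3 x y z : inner x y (inner x y (inner x y z)) = z.
Proof.
have h a : (x ** y) ** inner x y a = inner x y ((x ** y) ** a).
  by rewrite inner_morph inner_xy.
by apply: (@mulI (x ** y)); rewrite !h (mulC _ z) cycle1 cycle3 cycle2.
Qed.

(** Both sides equal [x ** ((inv x ** y) ** z)], by [cycle1] and [cycle3]. *)
Let inner_yz x y z : y ** inner x y z = z ** inner z x y.
Proof.
have h1 := cycle1 x (inv x ** y) z; have h2 := cycle3 z x (inv x ** y).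
rewrite -inner_xxy mulKV in h1; rewrite mulKV in h2.
by rewrite -inner_yM -inner_xM (mulC y) h2 -h1.
Qed.

(** Two instances of [inner_yz], at [inv x] and at [inv z], are combined by eliminating
    [inner x z y]. *)
Let inner_yx_def x y z :
  y ** inner y x z = z ** (z ** (y ** inv (inner x y z))).
Proof.
have h2 := inner_yz (inv x) y z; have h3 := inner_yz x y (inv z).
rewrite innerVx innerVy in h2; rewrite innerVx inner_inv in h3.
by rewrite h2 h3 mulKV.
Qed.

Let inner_swap x y z : x ** (y ** z) = y ** (x ** inner y x z).
Proof.
rewrite innerE (innerE y) (mulC y); congr (_ ** _).
by apply: (@inner_inj y x); rewrite innerK inner3.
Qed.

Let inner2 x y z : inner x y (inner x y z) = inner y x z.
Proof. by apply: (@inner_inj x y); rewrite inner3 innerK. Qed.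

(* Both [theta_{x,y}] and [theta_{x^-1,y^-1}] are the same map; comparing the two
   instances of [inner_yx_def] shows that the fourth power of [theta_{y,z}], that is
   [theta_{y,z}] itself, fixes [theta_{x,y} z]. *)
Let inner_fix x y z : inner y z (inner x y z) = inner x y z.
Proof.
set p := inner x y z.
have h1 := inner_yx_def x y z; have h2 := inner_yx_def (inv x) (inv y) z.
rewrite !innerV -/p in h1 h2.
have sw a : z ** (z ** (a ** inv p)) = a ** (z ** (z ** inner z a (inv p))).
  by rewrite (inner_swap z a) (inner_swap z a) inner_yM inner2.
rewrite sw in h1; rewrite sw innerVy in h2.
move/mulI: h1 => h1; move/mulI: h2; rewrite {}h1 => /mulI/mulI.
rewrite !inner_inv => h2; have h : inner z y p = inner y z p by rewrite -[LHS]invK h2 invK.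
by rewrite -[LHS]h -{2}(innerK y z p) -h inner2.
Qed.

Let inner_fix2 x y z : inner x z (inner x y z) = inner x y z.
Proof.
have := inner_fix y (inv x) z; rewrite innerVy innerVx => h.
by apply: (@inner_inj z x); rewrite h innerK.
Qed.

Let inner_yx_sqr x y z : inner y x z = z ** (z ** inv (inner x y z)).
Proof.
apply: (@mulI y); rewrite inner_yx_def (inner_swap z y) (inner_swap z y).
by rewrite !inner_inv inner_fix inner_morph innery inner_inv inner_fix.
Qed.

(** Each exchange of [y] with an [x] costs one [inner y x], and the cube of that map is the
    identity. *)
Lemma cml_cube_mulCA x y z : x ** (x ** (x ** (y ** z))) = y ** (x ** (x ** (x ** z))).
Proof.
rewrite (inner_swap x y) (inner_swap x y) (inner_swap x y).
by rewrite !inner_yM inner3.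
Qed.

Let cube_mul x z : (x ** (x ** x)) ** z = x ** (x ** (x ** z)).
Proof. by rewrite mulC -{3}(mule x) -cml_cube_mulCA mule. Qed.

Let inner_cube x y z : inner x y (z ** (z ** z)) = z ** (z ** z).
Proof. by rewrite /inner -{3}(mule z) -!cml_cube_mulCA mule mulVx mule. Qed.

(** * Associators and their centrality *)

(** The associator, normalised so that [inner x y z = z ** assoc x y z]. *)
Let assoc x y z := inv z ** inner x y z.

Let inner_yz_assoc x y z : inner y z (assoc x y z) = assoc x y z.
Proof. by rewrite inner_morph inner_fix inner_inv innery. Qed.

Let inner_xz_assoc x y z : inner x z (assoc x y z) = assoc x y z.
Proof. by rewrite inner_morph inner_fix2 inner_inv innery. Qed.

Let inner_xy_assoc x y z : inner x y (assoc x y z) = assoc x y z.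
Proof.
rewrite inner_morph inner_inv inner2 (inner_yx_sqr x y z) /assoc; set p := inner x y z.
(* Cubes are fixed by [inner], so [p] and [z] have the same cube. *)
have pE : p ** (p ** p) = z ** (z ** z) by rewrite /p -!inner_morph inner_cube.
apply: (@mulI p); rewrite mulKV; apply: (@mulI p).
rewrite -(sqr_mul z). rewrite (mulC _ (inv p)) mulKV (mulC (inv z)) -cube_mul pE cube_mul.
by rewrite mulxV mule.
Qed.

(** If [z] is fixed, then [z ** (x ** y)], [x ** (y ** z)] and [y ** (z ** x)] coincide, a condition
    invariant under rotation. *)
Let inner_fixed_rot x y z : inner x y z = z -> inner y z x = x.
Proof.
move=> fz; have fv : inner x y (z ** (x ** y)) = z ** (x ** y).
  by rewrite inner_morph inner_xy fz.
have vu : z ** (x ** y) = x ** (y ** z) by rewrite -[LHS]fv cycle1.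
have ut : x ** (y ** z) = y ** (z ** x) by rewrite -[RHS]cycle3 -vu fv.
have := cycle1 y z x; rewrite -ut inner_morph inner_xy => h.
by apply: (@mulI (y ** z)); rewrite mulC h mulC.
Qed.

Let inner_fixed_swap x y z : inner x y z = z -> inner y x z = z.
Proof. by move=> fz; rewrite -{1}fz innerK. Qed.

Let innerxx x z : inner x x z = z.
Proof. by rewrite /inner -sqr_mul mulK. Qed.

Let innerxe x z : inner x e z = z.
Proof. by rewrite /inner mul1 mule mulK. Qed.

(* The associator of three elements is central in the subloop they generate. *)
Let assoc_central x y z s t :
    s \in [:: x; y; z] -> t \in [:: x; y; z] -> inner s (assoc x y z) t = t.
Proof.
have rot u v : inner u v (assoc x y z) = assoc x y z -> inner u (assoc x y z) v = v.
  by move=> h; apply: inner_fixed_swap; do 2 apply: inner_fixed_rot.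
have h1 := inner_xy_assoc x y z; have h2 := inner_yz_assoc x y z.
have h3 := inner_xz_assoc x y z.
have := (inner_fixed_swap h1, inner_fixed_swap h2, inner_fixed_swap h3).
move=> [[h1' h2'] h3'].
by rewrite !inE => /or3P[] /eqP-> /or3P[] /eqP->; apply: rot => //; rewrite innerxx.
Qed.

Let assoc_central3 x y z x1 x2 x3 s t :
    all (mem [:: x; y; z]) [:: x1; x2; x3; s; t] ->
  inner s (assoc x1 x2 x3) t = t.
Proof.
case/and5P => h1 h2 h3 hs /andP[ht _].
have trivial_assoc : inner x1 x2 x3 = x3 -> inner s (assoc x1 x2 x3) t = t.
  by rewrite /assoc => ->; rewrite mulVx innerxe.
have [E|n12] := eqVneq x1 x2; first by apply: trivial_assoc; rewrite E innerxx.
have [E|n13] := eqVneq x1 x3; first by apply: trivial_assoc; rewrite E innerx.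
have [E|n23] := eqVneq x2 x3; first by apply: trivial_assoc; rewrite E innery.
(* Three distinct entries taken from [x], [y], [z] exhaust them. *)
have sub u : u \in [:: x; y; z] -> u \in [:: x1; x2; x3].
  have un : uniq [:: x1; x2; x3] by rewrite /= !inE negb_or n12 n13 n23.
  have sb : {subset [:: x1; x2; x3] <= [:: x; y; z]}.
    move=> w wi; rewrite !inE in wi; case/or3P: wi => /eqP->; [exact: h1|exact: h2|exact: h3].
  by have [_ ->] := uniq_min_size un sb (leqnn 3).
by apply: assoc_central; apply: sub.
Qed.

(** * Nilpotency of the group generated by the left translations *)

Let L (x : T) : {perm T} := perm (@mulI x).
Let LE x z : L x z = x ** z. Proof. exact: permE. Qed.
Let LV x z : (L x)^-1 z = inv x ** z.
Proof. by rewrite -[z in LHS](mulKV x) -LE permK. Qed.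

Let I x y : {perm T} := perm (@inner_inj x y).
Let IE x y z : I x y z = inner x y z. Proof. exact: permE. Qed.
Let IV x y z : (I x y)^-1 z = inner y x z.
Proof. by rewrite -[z in LHS](innerK y x) -IE permK. Qed.

Let permR (s t : {perm T}) z : ([~ s, t] : {perm T}) z = t (s (t^-1 (s^-1 z))).
Proof. by rewrite commgEl conjgE !permM. Qed.

Let comm_mul x y z : y ** (x ** (inv y ** (inv x ** z))) = inner x y z.
Proof. by rewrite inner_swap -inner_yM -inner_xM !mulKV. Qed.

Let comm_L x y : [~ L x, L y] = I x y.
Proof. by apply/permP => z; rewrite permR !LV !LE IE comm_mul. Qed.

(** The automorphism [I x y] conjugates [L z] to [L (z ** a)] with [a] the associator; [key]
    rewrites the resulting quotient of translations. *)
Let comm_I_L x y z :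
  [~ I x y, L z] = (I z (assoc x y z) * L (assoc x y z))^-1.
Proof.
set a := assoc x y z; set p := inner x y z.
have pE : z ** a = p by rewrite mulKV.
apply/permP => c; apply: (@perm_inj _ (I z a * L a)); rewrite permKV.
have key d : a ** inner z a d = p ** (inv z ** d).
  by rewrite (innerE p) innerVy -pE (mulC (z ** a)) inner_xxy mulK.
by rewrite permR LV IV permM !LE !IE key inner_morph innerK inner_inv mulK mulKV.
Qed.

Let comm_I_fixed x y z : inner x y z = z -> [~ I x y, L z] = 1.
Proof.
move=> fz; apply/permP => c.
by rewrite permR LV IV perm1 LE IE inner_morph innerK inner_inv fz mulKV.
Qed.

Let inner_conj u v x y z :
  inner u v (inner x y z) = inner (inner u v x) (inner u v y) (inner u v z).
Proof.
apply: (@mulI (inner u v x ** inner u v y)).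
by rewrite -[RHS]innerE -!inner_morph -innerE.
Qed.

Let comm_IL_L x a s :
    inner x a s = s -> [~ (I x a * L a)^-1, L s] = I s a.
Proof.
move=> fs; apply/permP => c; rewrite permR invgK permM LV !LE !IE.
have -> d : ((I x a * L a)^-1 : {perm T}) d = inner a x (inv a ** d).
  by apply: (@perm_inj _ (I x a * L a)); rewrite permKV permM IE LE innerK mulKV.
have fs' : inner a x s = s by rewrite -{1}fs innerK.
have cm d : s ** (inv a ** (inv s ** (a ** d))) = inner s a d.
  by have := comm_mul (inv a) s d; rewrite invK innerVx.
by rewrite -{1}fs' -inner_morph cm inner_conj innerK fs' innerx.
Qed.

(** The successive commutators are [I x1 x2], [(I x3 a * L a)^-1], [I x4 a] and [1], where
    [a = assoc x1 x2 x3]; the last two steps use its centrality. *)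
Let comm5 x y z x1 x2 x3 x4 x5 :
    all (mem [:: x; y; z]) [:: x1; x2; x3; x4; x5] ->
  [~ L x1, L x2, L x3, L x4, L x5] = 1.
Proof.
case/and5P => h1 h2 h3 h4 /andP[h5 _].
rewrite comm_L comm_I_L comm_IL_L ?comm_I_fixed //.
  by apply: (@assoc_central3 x y z); apply/and5P; split=> //; apply/andP.
by apply: (@assoc_central3 x y z); apply/and5P; split=> //; apply/andP.
Qed.

Let nilpotent_L3 x y z : nilpotent <<[set L x; L y; L z]>>.
Proof.
have inP p : p \in [set L x; L y; L z] -> exists2 u, p = L u & u \in [:: x; y; z].
  rewrite !inE -orbA => /or3P[] /eqP->; [exists x|exists y|exists z] => //;
  by rewrite !inE eqxx ?orbT.
apply: nilpotent_gen_comm5 => a b c d f.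
move=> /inP[x1 -> h1] /inP[x2 -> h2] /inP[x3 -> h3] /inP[x4 -> h4] /inP[x5 -> h5].
by apply: (@comm5 x y z); apply/and5P; split=> //; apply/andP.
Qed.

Let cube_comm x y : commute (L x ^+ 3) (L y).
Proof. by apply/permP => z; rewrite !permM !LE cml_cube_mulCA. Qed.

Let X : {set {perm T}} := [set L x | x in T].

(** Left translations satisfy this by [cml_mulMM], and the condition is stable under composition. *)
Let gen_pseudo g : g \in <<X>> -> forall a b, g a ** g b = g e ** g (a ** b).
Proof.
pose P := [set g : {perm T} |
  [forall a, forall b, g a ** g b == g e ** g (a ** b)]].
have PP (h : {perm T}) : reflect (forall a b, h a ** h b = h e ** h (a ** b)) (h \in P).
  rewrite inE; apply: (iffP forallP) => [H a b|H a]; last by apply/forallP => b; rewrite H.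
  by have /forallP/(_ b)/eqP := H a.
have gP : group_set P.
  apply/group_setP; split; first by apply/PP => a b; rewrite !perm1 mul1.
  move=> h k /PP hP /PP kP; apply/PP => a b; rewrite !permM.
  by rewrite kP hP -kP.
have sXP : <<X>> \subset Group gP.
  rewrite gen_subG; apply/subsetP => _ /imsetP[x _ ->]; apply/PP => a b.
  by rewrite !LE cml_mulMM mule.
by move=> /(subsetP sXP)/PP.
Qed.

Let L_conj g x : g \in <<X>> -> (L x) ^ g = L (g x) * (L (g e))^-1.
Proof.
move=> gX; apply/permP => c; rewrite conjgE !permM LE LV LE.
have := gen_pseudo gX x (g^-1 c); rewrite permKV => ->.
by rewrite mulK.
Qed.

Let nilpotent_X : nilpotent <<X>>.
Proof.
apply: nilpotent_gen_central_cubes => [_ _ /imsetP[x _ ->] /imsetP[y _ ->]|].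
  exact: cube_comm.
move=> _ g /imsetP[x _ ->] gX.
apply: (nilpotentS _ (nilpotent_L3 x (g x) (g e))).
rewrite gen_subG; apply/subsetP => p; rewrite !inE L_conj // => /orP[] /eqP->.
  by rewrite mem_gen // !inE eqxx.
by rewrite groupM ?groupV // mem_gen // !inE eqxx ?orbT.
Qed.

Let H (A : {set T}) := <<[set L x | x in A]>>%G.

Let orbit_H (A : {set T}) : e \in A -> (forall a b, a \in A -> b \in A -> a ** b \in A) ->
  orbit 'P (H A) e = A.
Proof.
move=> eA mA; apply/setP => a; apply/idP/idP => [/orbitP[g gH <-]|aA].
  have sH : H A \subset 'N(A | 'P).
    rewrite gen_subG; apply/subsetP => _ /imsetP[x xA ->].
    rewrite !inE; apply/subsetP => y yA; rewrite !inE /= /aperm LE; exact: mA.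
  by rewrite (astabs_act _ (subsetP sH _ gH)).
apply/orbitP; exists (L a); last by rewrite /= /aperm LE mule.
by rewrite mem_gen // imset_f.
Qed.

Lemma cml_card_dvd (A B : {set T}) : A \subset B -> e \in A ->
    (forall a b, a \in A -> b \in A -> a ** b \in A) ->
    (forall a b, a \in B -> b \in B -> a ** b \in B) ->
  #|A| %| #|B|.
Proof.
move=> sAB eA mA mB; have eB := subsetP sAB e eA.
have sH : H A \subset H B by rewrite genS ?imsetS.
have nB : nilpotent (H B).
  by apply: nilpotentS nilpotent_X; rewrite genS ?imsetS //; apply/subsetP.
have idx (C : {set T}) : e \in C -> (forall a b, a \in C -> b \in C -> a ** b \in C) ->
    #|C| = #|H C : H C :&: 'C[e | 'P]|.
  by move=> eC mC; rewrite -[in LHS](orbit_H eC mC) card_orbit.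
rewrite (idx A) // (idx B) //.
have -> : H A :&: 'C[e | 'P] = H A :&: (H B :&: 'C[e | 'P]).
  by rewrite setIA (setIidPl sH).
by apply: index_capI_dvd_nilpotent; rewrite ?subsetIl.
Qed.

End CommutativeMoufangLoop.

(** * Left automorphic Moufang loops and the left nucleus *)

Section LeftAutomorphicMoufangLoop.
Variables (T : finType) (mul : T -> T -> T) (e : T).
Local Notation "x ** y" := (mul x y) (at level 40, left associativity).
Hypothesis loopT : is_loop mul e.
Hypothesis mulM : moufang mul.
Hypothesis autT : left_automorphic mul e.

Let mul1 x : e ** x = x. Proof. by case: loopT. Qed.
Let mule x : x ** e = x. Proof. by case: loopT. Qed.
Let mulI x : injective (mul x).
Proof. by case: loopT => _ _ bij _; apply: bij_inj. Qed.
Let mulIr x : injective (mul^~ x).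
Proof. by case: loopT => _ _ _ bij; apply: bij_inj (bij x). Qed.

Let inv x := odflt e [pick y | x ** y == e].
Let mulxV x : x ** inv x = e.
Proof.
rewrite /inv; case: pickP => [y /eqP //|no].
by case: loopT => _ _ /(_ x)[g _ gK] _; have := no (g e); rewrite gK eqxx.
Qed.

Let mulK x y : inv x ** (x ** y) = y.
Proof. by apply: (@mulI x); rewrite -mulM mulxV mul1. Qed.

Let mulVx x : inv x ** x = e.
Proof. by rewrite -{2}(mule x) mulK. Qed.

Let invK x : inv (inv x) = x.
Proof. by apply: (@mulI (inv x)); rewrite mulxV mulVx. Qed.

Let mulKV x y : x ** (inv x ** y) = y.
Proof. by rewrite -{1}(invK x) mulK. Qed.

Let flexible x y : (x ** y) ** x = x ** (y ** x).
Proof. by have := mulM x y e; rewrite !mule. Qed.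

Let mulrK x y : (y ** x) ** inv x = y.
Proof. by have := mulM x (inv x ** y) (inv x); rewrite mulxV mule mulKV. Qed.

Let mulrKV x y : (y ** inv x) ** x = y.
Proof. by rewrite -{2}(invK x) mulrK. Qed.

Let invM x y : inv (x ** y) = inv y ** inv x.
Proof.
have h : inv y = inv (x ** y) ** x by rewrite -[X in _ ** X](mulrK y x) mulK.
by rewrite h mulrK.
Qed.

Let middle_moufang x c d : (x ** c) ** (d ** x) = (x ** (c ** d)) ** x.
Proof.
have h : (x ** (c ** d) ** x) ** (inv x ** inv d) = x ** c.
  by rewrite mulM mulKV mulrK.
by rewrite -h -invM mulrKV.
Qed.

Let L (x : T) : {perm T} := perm (@mulI x).
Let LE x z : L x z = x ** z. Proof. exact: permE. Qed.
Let LV x z : (L x)^-1 z = inv x ** z.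
Proof. by rewrite -[z in LHS](mulKV x) -LE permK. Qed.

Let L_left_translation x : L x \in <<left_translations mul>>.
Proof.
by rewrite mem_gen // inE; apply/existsP; exists x; apply/forallP => z; rewrite LE.
Qed.

Lemma left_inner_morph x y a b :
  let f z := inv (x ** y) ** (x ** (y ** z)) in f (a ** b) = f a ** f b.
Proof.
pose p := L y * L x * (L (x ** y))^-1.
have pE z : p z = inv (x ** y) ** (x ** (y ** z)) by rewrite !permM LV !LE.
have /autT pM : p \in left_inner_maps mul e.
  by rewrite inE !groupM ?groupV ?L_left_translation //= pE mule mulVx.
by have := pM a b; rewrite !pE.
Qed.

Let Nuc := [set n | [forall a, forall b, (n ** a) ** b == n ** (a ** b)]].
Let NucP n : reflect (forall a b, (n ** a) ** b = n ** (a ** b)) (n \in Nuc).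
Proof.
rewrite inE; apply: (iffP forallP) => [H a b|H a].
  by have /forallP/(_ b)/eqP := H a.
by apply/forallP => b; rewrite H.
Qed.

Let Nuc1 : e \in Nuc. Proof. by apply/NucP => a b; rewrite !mul1. Qed.
Let NucM n m : n \in Nuc -> m \in Nuc -> n ** m \in Nuc.
Proof. by move=> /NucP hn /NucP hm; apply/NucP => a b; rewrite !hn hm. Qed.
Let NucV n : n \in Nuc -> inv n \in Nuc.
Proof.
by move=> /NucP hn; apply/NucP => a b; apply: (@mulI n); rewrite mulKV -hn mulKV.
Qed.

(* Every [a] is of the form [(xy)x], so that the Moufang identity expands [ab]. *)
Let Nuc_conj n x : n \in Nuc ->
  exists2 m, m \in Nuc & forall y, x ** (n ** y) = m ** (x ** y).
Proof.
move=> /NucP hn; pose f c := x ** (n ** (inv x ** c)).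
have fM a b : f (a ** b) = f a ** b.
  pose y := inv x ** (a ** inv x).
  have -> : a = (x ** y) ** x by rewrite mulKV mulrKV.
  by rewrite /f mulM mulK -hn -mulM (flexible x y) mulK -hn flexible.
have fE c : f c = f e ** c by rewrite -fM mul1.
exists (f e); last by move=> y; rewrite -fE /f mulK.
by apply/NucP => a b; rewrite -!fE fM.
Qed.

(* The middle Moufang identity for [x], [y] and [w = yx] gives
   [f a (g b) = f 1 (g (ab))], where [f] is built from left and [g] from right
   translations; [g] is an automorphism because inversion conjugates it to a left
   inner map, hence [f 1 = w^-1 (xy)] is left nuclear. *)
Let Nuc_comm x y : exists2 m, m \in Nuc & x ** y = m ** (y ** x).
Proof.
set w := y ** x.
pose g b := ((b ** y) ** x) ** inv w.
have gM a b : g (a ** b) = g a ** g b.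
  pose k z := inv (inv x ** inv y) ** (inv x ** (inv y ** z)).
  have gE c : g c = inv (k (inv c)) by rewrite /g /k /w !invM !invK.
  by rewrite !gE (invM a b) -(invM (k _) (k _)); congr (inv _); apply: left_inner_morph.
have gE b : (b ** y) ** x = g b ** w by rewrite mulrKV.
pose f a := inv w ** (x ** (y ** a)).
have fE a : x ** (y ** a) = w ** f a by rewrite mulKV.
have fgE a b : f a ** g b = f e ** g (a ** b).
  apply: (@mulI w); apply: (@mulIr w) => /=.
  rewrite -!middle_moufang -!fE -!gE !middle_moufang.
  by rewrite mul1.
have g1 : g e = e by rewrite /g mul1 mulxV.
have nN : f e \in Nuc.
  have surj c : exists d, c = g d.
    by exists (((c ** w) ** inv x) ** inv y); rewrite /g !mulrKV mulrK.
  have fE1 c : f e ** g c = f c by have := fgE c e; rewrite g1 !mule.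
  apply/NucP => a b; have [c ->] := surj a; have [d ->] := surj b.
  by rewrite fE1 fgE gM.
have [m mN mE] := Nuc_conj w nN.
by exists m => //; rewrite -[w]mule -mE mule mulKV mule.
Qed.

(** * The commutative quotient by the left nucleus *)

Let cls x := [set mul n x | n in Nuc].

Let cls_id x : x \in cls x.
Proof. by apply/imsetP; exists e; rewrite ?mul1 ?Nuc1. Qed.

Let clsE x y : x \in cls y -> cls x = cls y.
Proof.
have sub u v : u \in cls v -> cls u \subset cls v.
  move=> /imsetP[n nN ->]; apply/subsetP => _ /imsetP[m mN ->].
  apply/imsetP; exists (m ** n); first exact: NucM.
  by have /NucP -> := mN.
move=> xy; apply/eqP; rewrite eqEsubset !sub //.
have /imsetP[n nN ->] := xy; apply/imsetP; exists (inv n); first exact: NucV.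
by rewrite mulK.
Qed.

Let cls_mul x y u v : u \in cls x -> v \in cls y -> u ** v \in cls (x ** y).
Proof.
move=> /imsetP[n nN ->] /imsetP[m mN ->].
have [k kN kE] := Nuc_conj x mN.
apply/imsetP; exists (n ** k); first exact: NucM.
by have /NucP -> := nN; have /NucP -> := nN; rewrite kE.
Qed.

(** A canonical representative, depending only on the set [cls x]; as this set contains [x], the
    default [e] is never taken. The fixed points of [r] encode the quotient. *)
Let r x := odflt e [pick y in cls x].
Let r_cls x : r x \in cls x.
Proof. by rewrite /r; case: pickP => //= /(_ x); rewrite cls_id. Qed.
Let cls_r x : cls (r x) = cls x. Proof. exact/clsE/r_cls. Qed.
Let r_eq x y : x \in cls y -> r x = r y.
Proof. by move=> /clsE xy; rewrite /r xy. Qed.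
Let r_id x : r (r x) == r x. Proof. exact/eqP/r_eq/r_cls. Qed.

Let Q := {x : T | r x == x}.
Let pi x : Q := exist _ (r x) (r_id x).
Let pi_val (a : Q) : pi (val a) = a.
Proof. by apply: val_inj; exact/eqP/(valP a). Qed.
Let pi_eq x y : (pi x == pi y) = (x \in cls y).
Proof.
apply/eqP/idP => [/(congr1 val) /= xy|xy]; last by apply: val_inj; apply: r_eq.
by rewrite -(cls_r y) -xy cls_r.
Qed.

Let mulQ (a b : Q) := pi (val a ** val b).
Let piM x y : mulQ (pi x) (pi y) = pi (x ** y).
Proof. by apply/eqP; rewrite pi_eq cls_mul // r_cls. Qed.

(** * Lagrange's theorem for subloops *)

Lemma left_automorphic_moufang_card_dvd (A B : {set T}) :
    A \subset B -> subloop mul e A -> subloop mul e B -> #|A| %| #|B|.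
Proof.
move=> sAB subA subB; have [eA mA _ _] := subA; have [_ mB _ _] := subB.
(* The fibre over [pi x] in [C] is the translate of [C :&: Nuc] by [x] on the right: closure under
   right division puts the nuclear factor in [C]. *)
have cardE (C : {set T}) : subloop mul e C -> #|C| = (#|pi @: C| * #|C :&: Nuc|)%N.
  move=> [eC mC _ rC]; rewrite -sum1_card (partition_big_imset pi) /= -sum_nat_const.
  apply: eq_bigr => _ /imsetP[x xC ->].
  rewrite sum1dep_card -[RHS](card_imset _ (@mulIr x)); apply: eq_card => y.
  rewrite !inE pi_eq; apply/andP/imsetP => [[yC /imsetP[n nN yE]]|[n nCN ->]].
    by exists n => //; rewrite inE nN andbT; apply: (rC x y) => //; rewrite yE.
  by move: nCN; rewrite inE => /andP[nC nN]; rewrite mC // imset_f.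
rewrite (cardE A) // (cardE B) //.
apply: dvdn_mul.
  have surj (P : Q -> Prop) : (forall x, P (pi x)) -> forall a, P a.
    by move=> h a; rewrite -(pi_val a).
  apply: (@cml_card_dvd _ mulQ (pi e) (fun a => pi (inv (val a)))).
  - elim/surj => x; elim/surj => y; rewrite !piM; apply/eqP; rewrite pi_eq.
    by have [m mN ->] := Nuc_comm x y; apply: imset_f.
  - by elim/surj => x; rewrite piM mul1.
  - move=> a; elim/surj => y; move: (val a) (pi_val a) => x <-.
    by rewrite !piM mulK.
  - move=> a; elim/surj => y; move: (val a) (pi_val a) => x <-.
    by rewrite !piM mulKV.
  - by elim/surj => x; elim/surj => y; elim/surj => z; rewrite !piM mulM.
  - exact: imsetS.
  - exact: imset_f.
  - by move=> _ _ /imsetP[x xA ->] /imsetP[y yA ->]; rewrite piM imset_f ?mA.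
  - by move=> _ _ /imsetP[x xA ->] /imsetP[y yA ->]; rewrite piM imset_f ?mB.
(* [C :&: Nuc] becomes a permutation group, so that Lagrange's theorem for groups applies.
   Permutations compose from left to right, whence [m ** n]. *)
have gP (C : {set T}) : subloop mul e C -> group_set [set L n | n in C :&: Nuc].
  move=> [eC mC _ _]; apply/group_setP; split.
    apply/imsetP; exists e; first by rewrite inE eC Nuc1.
    by apply/permP => z; rewrite LE perm1 mul1.
  move=> _ _ /imsetP[n /setIP[nC nN] ->] /imsetP[m /setIP[mC' mN] ->].
  apply/imsetP; exists (m ** n); first by rewrite inE mC ?NucM.
  by apply/permP => z; rewrite permM !LE; have /NucP -> := mN.
have Linj : injective L.
  by move=> x y /permP/(_ e); rewrite !LE !mule.
have cardL (C : {set T}) : #|C :&: Nuc| = #|[set L n | n in C :&: Nuc]|.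
  by rewrite card_imset.
rewrite !cardL.
apply: (@cardSg _ (Group (gP B subB)) (Group (gP A subA))) => /=; apply: imsetS; exact: setSI.
Qed.

(** * Intersections of cosets *)

Lemma card_coset_meet (S : {set T}) (x y : T) : subloop mul e S ->
    loop_lcoset mul x S :&: loop_lcoset mul y S != set0 ->
  exists U : {set T}, [/\ subloop mul e U, U \subset S &
    #|loop_lcoset mul x S :&: loop_lcoset mul y S| = #|U|].
Proof.
move=> [eS mS dS rS] /set0Pn[z /setIP[/imsetP[s sS zx] /imsetP[t tS zy]]].
pose f u := inv (x ** s) ** (x ** (s ** u)).
pose g v := inv (y ** t) ** (y ** (t ** v)).
have fM a b : f (a ** b) = f a ** f b by apply: left_inner_morph.
have gM a b : g (a ** b) = g a ** g b by apply: left_inner_morph.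
have fE u : x ** (s ** u) = z ** f u by rewrite zx mulKV.
have gE v : y ** (t ** v) = z ** g v by rewrite zy mulKV.
have divS a b : a \in S -> b \in S -> inv a ** b \in S.
  by move=> aS bS; apply: (dS a b) => //; rewrite mulKV.
pose U := [set u in S | f u \in g @: S].
have UP u : reflect (u \in S /\ exists2 v, v \in S & f u = g v) (u \in U).
  by rewrite inE; apply: (iffP andP) => -[uS /imsetP].
exists U; split; last 1 first.
(* The injection sending [u] to [x ** (s ** u)] maps [U] onto the intersection: [f u = g v] means
   [x ** (s ** u) = y ** (t ** v)]. *)
- rewrite -(card_imset U (inj_comp (@mulI x) (@mulI s))); apply: eq_card => w.
  rewrite inE; apply/andP/imsetP => [[/imsetP[a aS wx] /imsetP[b bS wy]]|[u /UP[uS [v vS uv]] ->]].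
    exists (inv s ** a); last by rewrite /= mulKV.
    apply/UP; split; first exact: divS.
    exists (inv t ** b); first exact: divS.
    by apply: (@mulI z); rewrite -fE -gE !mulKV -wx.
  split; first by rewrite /= imset_f ?mS.
  by rewrite /= fE uv -gE imset_f ?mS.
- split.
  + apply/UP; split=> //; exists e => //.
    by rewrite /f /g !mule !mulVx.
  + move=> a b /UP[aS [v vS av]] /UP[bS [w wS bw]]; apply/UP; split; first exact: mS.
    by exists (v ** w); rewrite ?mS // fM gM av bw.
  + move=> a b c /UP[aS [v vS av]] /UP[bS [w wS bw]] acb; apply/UP.
    split; first exact: dS acb.
    exists (inv v ** w); first exact: divS.
    by apply: (@mulI (f a)); rewrite -fM acb av -gM mulKV.
  + move=> a b c /UP[aS [v vS av]] /UP[bS [w wS bw]] cab; apply/UP.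
    split; first exact: rS cab.
    exists (w ** inv v); first by apply: (rS v w) => //; rewrite mulrKV.
    by apply: (@mulIr (f a)); rewrite /= -fM cab av -gM mulrKV.
- by apply/subsetP => u /UP[].
Qed.
End LeftAutomorphicMoufangLoop.

Theorem theorem6p8 (T : finType) (mul : T -> T -> T) (e : T)
  (Hloop : is_loop mul e) (Hmouf : moufang mul) (Hla : left_automorphic mul e)
  (S : {set T}) (HS : subloop mul e S) (x y : T)
  (Hne : loop_lcoset mul x S :&: loop_lcoset mul y S != set0) :
  (exists U : {set T}, [/\ subloop mul e U, U \subset S &
     #|loop_lcoset mul x S :&: loop_lcoset mul y S| = #|U|])
  /\ (#|loop_lcoset mul x S :&: loop_lcoset mul y S| %| #|S|)%N.
Proof.
have [U [subU sUS ->]] := card_coset_meet Hloop Hmouf Hla HS Hne.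
split; first by exists U.
exact: left_automorphic_moufang_card_dvd Hloop Hmouf Hla _ _ sUS subU HS.
Qed.
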